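(* The functor $\Omega^\bullet\colon\bigl(\widehat{\mathsf{SS}}^{\mathrm{ns}}_{\leq n}\bigr)^{\mathrm{op}}\to\mathsf{Im}_n$, $\widehat S\mapsto\Omega_S^\bullet$, $\widehat g\mapsto g^*$, is faithful.
   Context: $\Bbbk$ is a field of characteristic different from $2$; $n\ge0$. An $n$-truncated (semi)simplicial set is a contravariant functor to sets from the category of ordered sets $[0],\dots,[n]$ with order-preserving maps (resp. injections). $\mathsf{SS}^{\mathrm{ns}}_{\leq n}$ is the full subcategory of $n$-truncated semisimplicial sets $S$ with finitely many simplices such that every simplex is determined by its ordered tuple of vertices and every positive-dimensional simplex has pairwise distinct vertices; $[v_0,\dots,v_p]$ denotes the simplex with those ordered vertices. $U$ is the forgetful functor from $n$-truncated simplicial to semisimplicial sets, $L$ its left adjoint, $L(S)_p=\coprod_{\pi\colon[p]\twoheadrightarrow[q]}S_q$, $\widehat S:=UL(S)$. $\widehat{\mathsf{SS}}^{\mathrm{ns}}_{\leq n}$ is the full subcategory of $n$-truncated semisimplicial sets spanned by the $\widehat S$, $S\in\mathsf{SS}^{\mathrm{ns}}_{\leq n}$. Every morphism $\widehat g\colon\widehat S\to\widehat T$ underlies a unique simplicial map $g\colon L(S)\to L(T)$, with degree-zero part $g_0\colon S_0\to T_0$. $\mathsf{DG}_n$ is the category of differential graded $\Bbbk$-algebras concentrated in degrees $0,\dots,n$, with unital degree-preserving algebra maps commuting with the differentials. $\Omega_S^\bullet\in\mathsf{DG}_n$: $\Omega_S^p$ has basis $\{\rho_\sigma\}_{\sigma\in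 S_p}$ (with $\Omega_S^0=\Bbbk(S_0)$, $\rho_{[v]}=\delta_v$ the indicator functions); $\rho_{[v_0,\dots,v_p]}\wedge\rho_{[w_0,\dots,w_q]}=\rho_{[v_0,\dots,v_p,w_1,\dots,w_q]}$ if $v_p=w_0$ and that tuple is a simplex of $S$, $0$ otherwise; $d\rho_\sigma=\sum_{j=0}^{p+1}(-1)^j\sum_{\tau\in S_{p+1},d_j\tau=\sigma}\rho_\tau$. On morphisms, $g^*\colon\Omega_T^\bullet\to\Omega_S^\bullet$ is $g^*(\rho_{[w_0,\dots,w_p]})=\sum\rho_{[v_0,\dots,v_p]}$ over all $[v_0,\dots,v_p]\in S_p$ with $g_0(v_i)=w_i$ for all $i$. $\mathsf{Im}_n\subseteq\mathsf{DG}_n$ is the full subcategory spanned by the objects $\Omega_S^\bullet$, $S\in\mathsf{SS}^{\mathrm{ns}}_{\leq n}$. *)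

(* Defs.v *)
From HB Require Import structures.
From mathcomp Require Import all_boot all_order all_algebra.
From mathcomp Require Import zify ring.
From mathcomp Require Import boolp.

Set Implicit Arguments.
Unset Strict Implicit.
Unset Printing Implicit Defensive.
Obligation Tactic := idtac.

Import Order.TTheory GRing.Theory.

Record category := Category {
  ob :> Type;
  hom : ob -> ob -> Type;
  idc : forall a, hom a a;
  comp : forall a b c, hom b c -> hom a b -> hom a c;
  comp1c : forall a b (f : hom a b), comp (idc b) f = f;
  compc1 : forall a b (f : hom a b), comp f (idc a) = f;
  compcA : forall a b c d (h : hom c d) (g : hom b c) (f : hom a b),
    comp h (comp g f) = comp (comp h g) f }.
Arguments hom {_} _ _.
Arguments idc {_} _.
Arguments comp {_ _ _ _} _ _.

Definition op (C : category) : category :=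
  @Category C (fun a b => hom b a) (fun a => idc a)
    (fun a b c g f => comp f g) (fun _ _ f => compc1 f) (fun _ _ f => comp1c f)
    (fun _ _ _ _ h g f => esym (compcA f g h)).

Record functor (C D : category) := Functor {
  fobj :> C -> D;
  fmap : forall a b, hom a b -> hom (fobj a) (fobj b);
  fmap1 : forall a, fmap (idc a) = idc (fobj a);
  fmapM : forall a b c (g : hom b c) (f : hom a b),
    fmap (comp g f) = comp (fmap g) (fmap f) }.
Arguments fmap {_ _} _ {_ _} _.

Definition faithful (C D : category) (F : functor C D) : Prop :=
  forall a b : C, injective (@fmap C D F a b).

Definition opF (C D : category) (F : functor C D) : functor (op C) (op D) :=
  @Functor (op C) (op D) F (fun a b (f : @hom (op C) a b) => fmap F f)
    (fun a => fmap1 F a) (fun _ _ _ g f => fmapM F f g).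

Program Definition compF (C D E : category) (G : functor D E) (F : functor C D) :
    functor C E :=
  @Functor C E (fun a => G (F a)) (fun a b f => fmap G (fmap F f)) _ _.
Next Obligation.
by move=> C D E G F a; apply: etrans (congr1 _ (fmap1 F a)) (fmap1 G _).
Qed.
Next Obligation.
by move=> C D E G F a b c g f; apply: etrans (congr1 _ (fmapM F g f)) (fmapM G _ _).
Qed.

Record nat_trans (C D : category) (F G : functor C D) := NatTrans {
  ntc :> forall a, hom (F a) (G a);
  ntN : forall a b (f : hom a b), comp (ntc b) (fmap F f) = comp (fmap G f) (ntc a) }.

Lemma nat_trans_eq (C D : category) (F G : functor C D) (s t : nat_trans F G) :
  (forall a, s a = t a) -> s = t.
Proof.
case: s t => [s sN] [t tN] /= st.
have E : s = t by apply: functional_extensionality_dep.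
by rewrite -E in tN *; congr NatTrans; apply: Prop_irrelevance.
Qed.

Program Definition functor_cat (C D : category) : category :=
  @Category (functor C D) (@nat_trans C D)
    (fun F => @NatTrans _ _ F F (fun a => idc (F a)) _)
    (fun F G H t s => @NatTrans _ _ F H (fun a => comp (t a) (s a)) _) _ _ _.
Next Obligation. by move=> *; rewrite comp1c compc1. Qed.
Next Obligation. by move=> C D F G H t s a b f; rewrite -compcA ntN compcA ntN compcA. Qed.
Next Obligation. by move=> *; apply: nat_trans_eq => a /=; rewrite comp1c. Qed.
Next Obligation. by move=> *; apply: nat_trans_eq => a /=; rewrite compc1. Qed.
Next Obligation. by move=> *; apply: nat_trans_eq => a /=; rewrite compcA. Qed.

(* The full subcategory of [C] spanned by a family of objects, the objects being
   represented by their indices. *)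
Definition full_on (C : category) (I : Type) (f : I -> C) : category :=
  @Category I (fun i j => hom (f i) (f j)) (fun i => idc (f i))
    (fun i j k h g => comp h g) (fun _ _ g => comp1c g) (fun _ _ g => compc1 g)
    (fun _ _ _ _ h g f => compcA h g f).

Definition full_sub (C : category) (P : C -> Prop) : category :=
  full_on (fun x : {x : C | P x} => sval x).

Definition Sets : category :=
  @Category Type (fun X Y => X -> Y) (fun _ x => x) (fun _ _ _ g f x => g (f x))
    (fun _ _ _ => erefl) (fun _ _ _ => erefl) (fun _ _ _ _ _ _ _ => erefl).

Definition FinSets : category := full_on (fun X : finType => (X : Type) : Sets).

Definition forget_fin : functor FinSets Sets :=
  @Functor FinSets Sets (fun X => (X : Type)) (fun _ _ f => f)
    (fun _ => erefl) (fun _ _ _ _ _ => erefl).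

Definition monotone p q (f : {ffun 'I_p.+1 -> 'I_q.+1}) : bool :=
  [forall i : 'I_p.+1, forall j : 'I_p.+1, (i <= j) ==> (f i <= f j)].
Definition surjectiveb p q (f : {ffun 'I_p.+1 -> 'I_q.+1}) : bool :=
  [forall j, j \in codom f].

Definition dmap p q := {f : {ffun 'I_p.+1 -> 'I_q.+1} | monotone f}.
Definition dinj p q := {f : {ffun 'I_p.+1 -> 'I_q.+1} | monotone f && injectiveb f}.
Definition dsurj p q := {f : {ffun 'I_p.+1 -> 'I_q.+1} | monotone f && surjectiveb f}.

Definition ffcomp p q r (g : {ffun 'I_q.+1 -> 'I_r.+1}) (f : {ffun 'I_p.+1 -> 'I_q.+1}) :=
  [ffun i => g (f i)].

Lemma monotoneP p q (f : {ffun 'I_p.+1 -> 'I_q.+1}) :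
  reflect (forall i j : 'I_p.+1, i <= j -> f i <= f j) (monotone f).
Proof.
apply: (iffP forallP) => [H i j ij|H i]; last by apply/forallP => j; apply/implyP/H.
by move/forallP: (H i) => /(_ j) /implyP; apply.
Qed.

Lemma monotone_id p : monotone [ffun i : 'I_p.+1 => i].
Proof. by apply/monotoneP => i j; rewrite !ffunE. Qed.

Lemma monotone_comp p q r (g : {ffun 'I_q.+1 -> 'I_r.+1}) (f : {ffun 'I_p.+1 -> 'I_q.+1}) :
  monotone g -> monotone f -> monotone (ffcomp g f).
Proof.
by move=> /monotoneP gM /monotoneP fM; apply/monotoneP => i j ij; rewrite !ffunE gM ?fM.
Qed.

Lemma inj_id p : injectiveb [ffun i : 'I_p.+1 => i].
Proof. by apply/injectiveP => i j; rewrite !ffunE. Qed.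

Lemma surj_id p : surjectiveb [ffun i : 'I_p.+1 => i].
Proof. by apply/forallP => i; apply/codomP; exists i; rewrite ffunE. Qed.

Lemma inj_ffcomp p q r (g : {ffun 'I_q.+1 -> 'I_r.+1}) (f : {ffun 'I_p.+1 -> 'I_q.+1}) :
  injectiveb g -> injectiveb f -> injectiveb (ffcomp g f).
Proof.
move=> /injectiveP gI /injectiveP fI; apply/injectiveP => i j.
by rewrite !ffunE => /gI/fI.
Qed.

Program Definition dmap_id p : dmap p p := [ffun i => i].
Next Obligation. exact: monotone_id. Qed.

Program Definition dmap_comp p q r (g : dmap q r) (f : dmap p q) : dmap p r :=
  ffcomp (val g) (val f).
Next Obligation. by move=> p q r g f; apply: monotone_comp (valP g) (valP f). Qed.

Program Definition dinj_id p : dinj p p := [ffun i => i].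
Next Obligation. by move=> p; apply/andP; split; [apply: monotone_id|apply: inj_id]. Qed.

Program Definition dinj_comp p q r (g : dinj q r) (f : dinj p q) : dinj p r :=
  ffcomp (val g) (val f).
Next Obligation.
move=> p q r g f; have /andP[gM gI] := valP g; have /andP[fM fI] := valP f.
by apply/andP; split; [apply: monotone_comp|apply: inj_ffcomp].
Qed.

Program Definition dsurj_id p : dsurj p p := [ffun i => i].
Next Obligation. by move=> p; apply/andP; split; [apply: monotone_id|apply: surj_id]. Qed.

Program Definition dmap_of_inj p q (f : dinj p q) : dmap p q := val f.
Next Obligation. by move=> p q f; case/andP: (valP f). Qed.

Program Definition DeltaLe (n : nat) : category :=
  @Category 'I_n.+1 (fun p q => dmap p q) (fun p => dmap_id p)
    (fun p q r g f => dmap_comp g f) _ _ _.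
Next Obligation. by move=> *; apply/val_inj/ffunP => i; rewrite !ffunE. Qed.
Next Obligation. by move=> *; apply/val_inj/ffunP => i; rewrite !ffunE. Qed.
Next Obligation. by move=> *; apply/val_inj/ffunP => i; rewrite !ffunE. Qed.

Program Definition DeltaInjLe (n : nat) : category :=
  @Category 'I_n.+1 (fun p q => dinj p q) (fun p => dinj_id p)
    (fun p q r g f => dinj_comp g f) _ _ _.
Next Obligation. by move=> *; apply/val_inj/ffunP => i; rewrite !ffunE. Qed.
Next Obligation. by move=> *; apply/val_inj/ffunP => i; rewrite !ffunE. Qed.
Next Obligation. by move=> *; apply/val_inj/ffunP => i; rewrite !ffunE. Qed.

Program Definition DeltaIncl n : functor (DeltaInjLe n) (DeltaLe n) :=
  @Functor (DeltaInjLe n) (DeltaLe n) (fun p => p) (fun p q f => dmap_of_inj f) _ _.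
Next Obligation. by move=> *; apply/val_inj. Qed.
Next Obligation. by move=> *; apply/val_inj. Qed.

Definition sSet n : category := functor_cat (op (DeltaLe n)) Sets.
Definition ssSet n : category := functor_cat (op (DeltaInjLe n)) Sets.

Definition forgetU n (X : sSet n) : ssSet n := compF X (opF (DeltaIncl n)).

Section KernelLemma.
Variables p q1 q2 : nat.
Variables (f1 : dsurj p q1) (f2 : dsurj p q2).

Lemma dsurj_mono q (f : dsurj p q) (i j : 'I_p.+1) : i <= j -> val f i <= val f j.
Proof. by case: f => f /= /andP[/monotoneP + _]; apply. Qed.

Lemma dsurj_surj q (f : dsurj p q) j : exists i, val f i = j.
Proof.
by case: f => f /= /andP[_ /forallP/(_ j)/codomP[i ->]]; exists i.
Qed.

Lemma dsurj0 q (f : dsurj p q) : val f ord0 = ord0.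
Proof.
have [i fi] := dsurj_surj f ord0; apply/val_inj/eqP; rewrite /= -leqn0.
by rewrite -[X in _ <= X](congr1 val fi) dsurj_mono.
Qed.

Lemma dsurj_step q (f : dsurj p q) (i j : 'I_p.+1) : j = i.+1 :> nat ->
  val f j = (val f i + (val f i != val f j))%N :> nat.
Proof.
move=> ji; have le : val f i <= val f j by rewrite dsurj_mono // ji.
have [->|ne] := eqVneq (val f i) (val f j); first by rewrite addn0.
have lt : val f i < val f j by rewrite ltn_neqAle le andbT; apply: contra_neq ne => /val_inj.
rewrite addn1; apply/eqP; rewrite eqn_leq lt andbT leqNgt; apply/negP => H.
have Hb : (val f i).+1 < q.+1 by apply: leq_trans (ltn_ord (val f j)); apply: ltnW.
have [k fk] := dsurj_surj f (Ordinal Hb).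
have := congr1 val fk => /= fk'.
have [ki|ik] := leqP k i.
  by have := dsurj_mono f ki; rewrite fk' ltnn.
have : j <= k by rewrite ji.
by move/(dsurj_mono f); rewrite fk' leqNgt H.
Qed.

Hypothesis ker : forall i j, (val f1 i == val f1 j) = (val f2 i == val f2 j).

Lemma dsurj_ker_val (i : 'I_p.+1) : val f1 i = val f2 i :> nat.
Proof.
case: i => i; elim: i => [|i IH] Hi.
  have -> : Ordinal Hi = ord0 by apply: val_inj.
  by rewrite !dsurj0.
rewrite (@dsurj_step _ f1 (Ordinal (ltnW Hi))) // (@dsurj_step _ f2 (Ordinal (ltnW Hi))) //.
by rewrite ker IH.
Qed.

Lemma dsurj_max q (f : dsurj p q) : val f ord_max = q :> nat.
Proof.
have [i fi] := dsurj_surj f ord_max; apply/eqP; rewrite eqn_leq leq_ord /=.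
have /= fi' := congr1 val fi; apply: leq_trans (_ : val f i <= _).
  by rewrite fi'.
exact/dsurj_mono/leq_ord.
Qed.

Lemma dsurj_ker_eq : q1 = q2.
Proof. by rewrite -(dsurj_max f1) -(dsurj_max f2) dsurj_ker_val. Qed.

End KernelLemma.

Section Factorization.
Variable n : nat.
Implicit Types m p q : 'I_n.+1.

Record epi_mono m p (f : dmap m p) := EpiMono {
  em_mid : 'I_n.+1;
  em_epi : dsurj m em_mid;
  em_mono : dinj em_mid p;
  em_eq : forall i, val f i = val em_mono (val em_epi i) }.

Lemma dinj_inj p q (f : dinj p q) : injective (val f).
Proof. by case: f => f /= /andP[_ /injectiveP]. Qed.

(* The factorisation is unique, so transporting a simplex along its two parts
   does not depend on the choice. *)
Lemma epi_mono_unique m p (f : dmap m p) (E E' : epi_mono f) :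
  existT (fun q : 'I_n.+1 => dsurj m q * dinj q p)%type (em_mid E) (em_epi E, em_mono E)
  = existT _ (em_mid E') (em_epi E', em_mono E').
Proof.
case: E E' => [q s i E] [q' s' i' E'] /=.
have ker a b : (val s a == val s b) = (val s' a == val s' b).
  apply/eqP/eqP => ab; first by apply: (@dinj_inj _ _ i'); rewrite -!E' !E ab.
  by apply: (@dinj_inj _ _ i); rewrite -!E !E' ab.
have e : q = q' by apply: val_inj; apply: dsurj_ker_eq ker.
subst q'.
have es : s = s'.
  by apply/val_inj/ffunP => a; apply/val_inj/(dsurj_ker_val ker).
have ei : i = i'.
  apply/val_inj/ffunP => a.
  by have [b <-] := dsurj_surj s a; rewrite -E E' es.
by rewrite es ei.
Qed.

Section Image.
Variables (m p : 'I_n.+1) (f : dmap m p).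
Let A : {set 'I_p.+1} := [set x in codom (val f)].
Let c := #|A|.-1.

Lemma em_in i : val f i \in A.
Proof. by rewrite inE codom_f. Qed.

Lemma em_cardS : #|A| = c.+1.
Proof. by rewrite prednK //; apply/card_gt0P; exists (val f ord0); apply: em_in. Qed.

Lemma em_bound : c < n.+1.
Proof.
rewrite -em_cardS; apply: leq_trans (ltn_ord m).
by rewrite cardsE -[X in _ <= X]card_ord; apply: leq_image_card.
Qed.

Let mid : 'I_n.+1 := Ordinal em_bound.

Program Definition em_epi_of : dsurj m mid :=
  [ffun i => cast_ord em_cardS (Order.enum_rank_in (em_in ord0) (val f i))].
Next Obligation.
have rankK i : Order.enum_val (Order.enum_rank_in (em_in ord0) (val f i)) = val f i.
  by apply: Order.enum_rankK_in; apply: em_in.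
apply/andP; split.
  apply/monotoneP => i j ij; rewrite !ffunE /=.
  have := Order.le_enum_val (@le_total _ 'I_p.+1) (A := A)
    (Order.enum_rank_in (em_in ord0) (val f i))
    (Order.enum_rank_in (em_in ord0) (val f j)).
  rewrite !rankK => H.
  suff : (val f i <= val f j)%O by rewrite H.
  by case: (f) => g /= /monotoneP; apply.
apply/forallP => j; apply/codomP.
have := Order.enum_valP (cast_ord (esym em_cardS) j); rewrite inE => /codomP[i fi].
exists i; rewrite ffunE -fi Order.enum_valK_in.
by apply: val_inj.
Qed.

Program Definition em_mono_of : dinj mid p :=
  [ffun j => Order.enum_val (cast_ord (esym em_cardS) j)].
Next Obligation.
apply/andP; split.
  apply/monotoneP => i j ij; rewrite !ffunE.
  have := Order.le_enum_val (@le_total _ 'I_p.+1) (A := A) (cast_ord (esym em_cardS) i) (cast_ord (esym em_cardS) j).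
  by move=> H; move: ij; rewrite -[i <= j]/(cast_ord (esym em_cardS) i <= cast_ord (esym em_cardS) j)%O -H.
apply/injectiveP => i j; rewrite !ffunE => /Order.enum_val_inj /(congr1 val) /= ij.
exact: val_inj.
Qed.

Program Definition epi_mono_of : epi_mono f := @EpiMono _ _ f mid em_epi_of em_mono_of _.
Next Obligation.
move=> i; rewrite /= !ffunE.
rewrite (_ : cast_ord _ _ = Order.enum_rank_in (em_in ord0) (val f i)).
  by rewrite Order.enum_rankK_in // em_in.
exact: val_inj.
Qed.

End Image.
End Factorization.
Section LeftAdjoint.
Variables (n : nat) (X : functor (op (DeltaInjLe n)) Sets).
Implicit Types m p q : 'I_n.+1.

Definition act p q (f : dinj p q) : (X q : Type) -> (X p : Type) :=
  @fmap _ _ X q p f.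

Program Definition dmap_of_surj m q (s : dsurj m q) : dmap m q := val s.
Next Obligation. by move=> m q s; case/andP: (valP s). Qed.

Definition Lcell p : Type := {q : 'I_n.+1 & (dsurj p q * (X q : Type))%type}.

Definition Lmk m p (f : dmap m p) (E : epi_mono f) (x : X p : Type) : Lcell m :=
  existT _ (em_mid E) (em_epi E, act (em_mono E) x).

(* [f] acts on [(s, x)] through the epi-mono factorisation of [s \o f]: the
   surjective part is the new index, the injective part acts on [x]. *)
Definition Lact m p (f : dmap m p) (z : Lcell p) : Lcell m :=
  Lmk (epi_mono_of (dmap_comp (dmap_of_surj (projT2 z).1) f)) (projT2 z).2.

Lemma Lmk_irr m p (f f' : dmap m p) (E : epi_mono f) (E' : epi_mono f') (x : X p : Type) :
  f = f' -> Lmk E x = Lmk E' x.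
Proof.
move=> ff; subst f'; have := epi_mono_unique E E'.
by move/(congr1 (fun z => existT (fun q => dsurj m q * (X q : Type))%type
  (projT1 z) ((projT2 z).1, act (projT2 z).2 x))).
Qed.

Program Definition em_of_surj p q (s : dsurj p q) : epi_mono (dmap_of_surj s) :=
  @EpiMono n p q _ q s (dinj_id q) _.
Next Obligation. by move=> p q s i; rewrite /= ffunE. Qed.

Lemma Lact1 p (z : Lcell p) : Lact (dmap_id p) z = z.
Proof.
case: z => q [s x]; rewrite /Lact /=.
rewrite (@Lmk_irr _ _ _ _ _ (em_of_surj s)); last first.
  by apply/val_inj/ffunP => i; rewrite !ffunE.
apply: (congr1 (fun y => existT (fun q => dsurj p q * (X q : Type))%type q (s, y))).
exact: (congr1 (@^~ x) (fmap1 X q)).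
Qed.

Program Definition em_comp m p q (r : 'I_n.+1) (f : dmap m p) (s : dsurj p q) (t : dinj q r)
    (E : epi_mono (dmap_comp (dmap_of_surj s) f)) (g : dmap m r)
    (Eg : forall i, val g i = val t (val s (val f i))) : epi_mono g :=
  @EpiMono n m r _ (em_mid E) (em_epi E) (dinj_comp t (em_mono E)) _.
Next Obligation.
move=> m p q r f s t E g Eg i; rewrite Eg /= !ffunE -(em_eq E i).
by rewrite /= ffunE.
Qed.

Lemma LactM (l : 'I_n.+1) m p (f : dmap m p) (g : dmap l m) (z : Lcell p) :
  Lact (dmap_comp f g) z = Lact g (Lact f z).
Proof.
case: z => q [s x]; rewrite /Lact /=.
set E := epi_mono_of (dmap_comp (dmap_of_surj s) f).
set E' := epi_mono_of (dmap_comp (dmap_of_surj (em_epi E)) g).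
have H i : val (dmap_comp (dmap_of_surj s) (dmap_comp f g)) i
    = val (em_mono E) (val (em_epi E) (val g i)).
  by rewrite -(em_eq E) /= !ffunE.
rewrite (@Lmk_irr _ _ _ _ _ (em_comp E' H)) //.
apply: (congr1 (fun y => existT (fun q => dsurj l q * (X q : Type))%type _ (em_epi E', y))).
exact: (congr1 (@^~ x) (@fmapM _ _ X _ _ _
  (em_mono E' : @hom (op (DeltaInjLe n)) _ _) (em_mono E : @hom (op (DeltaInjLe n)) _ _))).
Qed.

Program Definition Lobj : sSet n :=
  @Functor (op (DeltaLe n)) Sets (fun p => Lcell p) (fun p m f => @Lact m p f) _ _.
Next Obligation. by move=> p; apply: funext => z; apply: Lact1. Qed.
Next Obligation. by move=> p m l g f; apply: funext => z; apply: LactM. Qed.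

End LeftAdjoint.

Program Definition vertex_map n (p : 'I_n.+1) (i : 'I_p.+1) :
  dinj (ord0 : 'I_n.+1) p := [ffun _ => i].
Next Obligation.
move=> n p i; apply/andP; split; first by apply/monotoneP => a b; rewrite !ffunE.
by apply/injectiveP => a b _; rewrite (ord1 a) (ord1 b).
Qed.

Definition vertex_of n (X : functor (op (DeltaInjLe n)) FinSets) (p : 'I_n.+1)
    (x : (X p : finType)) (i : 'I_p.+1) : (X ord0 : finType) :=
  @fmap _ _ X p ord0 (vertex_map i) x.

Record nsSet n := NsSet {
  ns_fun : functor (op (DeltaInjLe n)) FinSets;
  ns_determined : forall (p : 'I_n.+1) (x y : (ns_fun p : finType)),
    (forall i, vertex_of x i = vertex_of y i) -> x = y;
  ns_distinct : forall (p : 'I_n.+1) (x : (ns_fun p : finType)),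
    0 < p -> injective (vertex_of x) }.

Definition simp n (S : nsSet n) (p : 'I_n.+1) : finType := ns_fun S p.
Definition vertex n (S : nsSet n) p (x : simp S p) (i : 'I_p.+1) : simp S ord0 :=
  vertex_of x i.
Definition face n (S : nsSet n) (p q : 'I_n.+1) (f : dinj p q) (x : simp S q) : simp S p :=
  @fmap _ _ (ns_fun S) q p f x.

Definition ssSet_of n (S : nsSet n) : ssSet n := compF forget_fin (ns_fun S).

Definition hat n (S : nsSet n) : ssSet n := forgetU (Lobj (ssSet_of S)).

(* Objects are represented by the [S] presenting them as [hat S]. *)
Definition HatSS n : category := full_on (@hat n).

(* The identification of degree 0 of [hat S] with [simp S ord0]: a surjection
   from [0] has target [0]. *)
Definition hat_in0 n (S : nsSet n) (v : simp S ord0) : (hat S ord0 : Type) :=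
  existT _ ord0 (dsurj_id 0, v).
Definition hat_out0 n (S : nsSet n) (z : (hat S ord0 : Type)) : simp S ord0 :=
  let: existT q (s, x) := z in vertex (x : simp S q) (val s ord0).

(* [forgetU] does not change components, so this is also the degree-zero part of
   the simplicial map underlain by [g]. *)
Definition deg0 n (S T : nsSet n) (g : @hom (HatSS n) S T) (v : simp S ord0) : simp T ord0 :=
  hat_out0 (g ord0 (hat_in0 v)).

Local Open Scope ring_scope.

(* Not built on [algType], which requires [1 != 0]: the empty set gives the zero
   algebra. *)
Record dgAlg (k : fieldType) (n : nat) := DgAlg {
  dg_sort :> lmodType k;
  dg_one : dg_sort;
  dg_mul : dg_sort -> dg_sort -> dg_sort;
  dg_d : dg_sort -> dg_sort;
  dg_deg : nat -> dg_sort -> Prop;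
  dg_mulA : associative dg_mul;
  dg_mul1 : left_id dg_one dg_mul;
  dg_mulr1 : right_id dg_one dg_mul;
  dg_mull : forall y, linear (dg_mul^~ y);
  dg_mulr : forall x, linear (dg_mul x);
  dg_deg0 : forall p, dg_deg p 0;
  dg_degL : forall p (a : k) x y, dg_deg p x -> dg_deg p y -> dg_deg p (a *: x + y);
  dg_direct : forall x, exists! u : {ffun 'I_n.+1 -> dg_sort},
    (forall p : 'I_n.+1, dg_deg p (u p)) /\ x = \sum_p u p;
  dg_concentrated : forall p x, (n < p)%N -> dg_deg p x -> x = 0;
  dg_deg1 : dg_deg 0 dg_one;
  dg_degM : forall p q x y, dg_deg p x -> dg_deg q y -> dg_deg (p + q) (dg_mul x y);
  dg_dL : linear dg_d;
  dg_degd : forall p x, dg_deg p x -> dg_deg p.+1 (dg_d x);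
  dg_dd : forall x, dg_d (dg_d x) = 0;
  dg_leibniz : forall p x y, dg_deg p x ->
    dg_d (dg_mul x y) = dg_mul (dg_d x) y + (-1) ^+ p *: dg_mul x (dg_d y) }.

Record dgHom k n (A B : dgAlg k n) := DgHom {
  dgh :> A -> B;
  dgh_linear : linear dgh;
  dgh_one : dgh (dg_one A) = dg_one B;
  dgh_mul : forall x y, dgh (dg_mul x y) = dg_mul (dgh x) (dgh y);
  dgh_deg : forall p x, dg_deg p x -> dg_deg p (dgh x);
  dgh_d : forall x, dgh (dg_d x) = dg_d (dgh x) }.

Lemma dgHom_eq k n (A B : dgAlg k n) (f g : dgHom A B) : (forall x, f x = g x) -> f = g.
Proof.
case: f g => [f f1 f2 f3 f4 f5] [g g1 g2 g3 g4 g5] /= fg.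
have E : f = g by apply: funext.
by rewrite -E in g1 g2 g3 g4 g5 *; congr DgHom; apply: Prop_irrelevance.
Qed.

Program Definition DG k n : category :=
  @Category (dgAlg k n) (@dgHom k n)
    (fun A => @DgHom _ _ A A id _ _ _ _ _)
    (fun A B C g f => @DgHom _ _ A C (fun x => g (f x)) _ _ _ _ _) _ _ _.
Next Obligation. by []. Qed.
Next Obligation. by []. Qed.
Next Obligation. by []. Qed.
Next Obligation. by []. Qed.
Next Obligation. by []. Qed.
Next Obligation. by move=> k n A B C g f a x y; rewrite /= !dgh_linear. Qed.
Next Obligation. by move=> k n A B C g f; rewrite /= (dgh_one f) (dgh_one g). Qed.
Next Obligation. by move=> k n A B C g f x y; rewrite /= (dgh_mul f) (dgh_mul g). Qed.
Next Obligation. by move=> k n A B C g f p x xp; do 2!apply: dgh_deg. Qed.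
Next Obligation. by move=> k n A B C g f x; rewrite /= (dgh_d f) (dgh_d g). Qed.
Next Obligation. by move=> *; apply: dgHom_eq. Qed.
Next Obligation. by move=> *; apply: dgHom_eq. Qed.
Next Obligation. by move=> *; apply: dgHom_eq. Qed.

Program Definition coface n (p q : 'I_n.+1) (e : q = p.+1 :> nat) (j : 'I_q.+1) : dinj p q :=
  [ffun i : 'I_p.+1 => lift j (cast_ord (esym e) i)].
Next Obligation.
move=> n p q e j; apply/andP; split.
  by apply/monotoneP => a b ab; rewrite !ffunE /= /bump; lia.
by apply/injectiveP => a b; rewrite !ffunE => /lift_inj /cast_ord_inj.
Qed.

Section Omega.
Variables (k : fieldType) (n : nat) (S : nsSet n).

Definition tot := {p : 'I_n.+1 & simp S p}.

Definition verts (s : tot) : seq (simp S ord0) :=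
  [seq vertex (tagged s) i | i <- enum 'I_(tag s).+1].

Definition Omega := {ffun tot -> k^o}.
HB.instance Definition _ := GRing.Lmodule.copy Omega {ffun tot -> k^o}.

Definition rho (s : tot) : Omega := [ffun t => (t == s)%:R].

(* By [verts_inj] below there is at most one simplex to pick. *)
Definition wedge_rho (s t : tot) : Omega :=
  if vertex (tagged s) ord_max == vertex (tagged t) ord0 then
    if [pick u | verts u == verts s ++ behead (verts t)] is Some u then rho u else 0
  else 0.

Definition wedge (f g : Omega) : Omega :=
  \sum_s \sum_t (f s * g t) *: wedge_rho s t.

Definition Omega1 : Omega := \sum_(v : simp S ord0) rho (Tagged (simp S) v).

(* Only [q = tag s + 1] contributes, and only if it is at most [n]. *)
Definition diff_rho (s : tot) : Omega :=
  \sum_(q : 'I_n.+1)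
    if (q : nat) =P (tag s).+1 is ReflectT e then
      \sum_(j < q.+1) (-1) ^+ j *:
        \sum_(t : simp S q | face (coface e j) t == tagged s) rho (Tagged (simp S) t)
    else 0.

Definition diff (f : Omega) : Omega := \sum_s f s *: diff_rho s.

(* The span of the [rho s] with [s] of dimension [p]. *)
Definition Omega_deg (p : nat) (f : Omega) : Prop :=
  forall s : tot, tag s != p :> nat -> f s = 0.

End Omega.

Section SeqCochains.
Variables (k : comPzRingType) (V : Type).
Implicit Types (F G H : seq V -> k) (s t : seq V).

Definition del (j : nat) s := take j s ++ drop j.+1 s.
Definition cup F G s := \sum_(i < size s) F (take i.+1 s) * G (drop i s).
Definition cob F s := \sum_(j < size s) (-1) ^+ j * F (del j s).

Lemma cup_nil F G : cup F G [::] = 0. Proof. by rewrite /cup big_ord0. Qed.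
Lemma cob_nil F : cob F [::] = 0. Proof. by rewrite /cob big_ord0. Qed.

Lemma cup_cons F G x s :
  cup F G (x :: s) = F [:: x] * G (x :: s) + cup (fun t => F (x :: t)) G s.
Proof. by rewrite /cup big_ord_recl /= take0. Qed.

Lemma cob_cons F x s : cob F (x :: s) = F s - cob (fun t => F (x :: t)) s.
Proof.
rewrite /cob big_ord_recl /= expr0 mul1r /del /= drop0 -sumrN; congr (_ + _).
by apply: eq_bigr => j _; rewrite /bump /= add1n exprS mulN1r mulNr.
Qed.

Lemma eq_cup F F' G G' s : F =1 F' -> G =1 G' -> cup F G s = cup F' G' s.
Proof. by move=> FF GG; apply: eq_bigr => i _; rewrite FF GG. Qed.

Lemma eq_cob F F' s : F =1 F' -> cob F s = cob F' s.
Proof. by move=> FF; apply: eq_bigr => i _; rewrite FF. Qed.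

Lemma cupDl F F' G s : cup (fun t => F t + F' t) G s = cup F G s + cup F' G s.
Proof. by rewrite /cup -big_split; apply: eq_bigr => i _; rewrite mulrDl. Qed.

Lemma cupNl F G s : cup (fun t => - F t) G s = - cup F G s.
Proof. by rewrite /cup -sumrN; apply: eq_bigr => i _; rewrite mulNr. Qed.

Lemma cupZl a F G s : cup (fun t => a * F t) G s = a * cup F G s.
Proof. by rewrite /cup mulr_sumr; apply: eq_bigr => i _; rewrite mulrA. Qed.

Lemma cobD F F' s : cob (fun t => F t + F' t) s = cob F s + cob F' s.
Proof. by rewrite /cob -big_split; apply: eq_bigr => i _; rewrite mulrDr. Qed.

Lemma cobN F s : cob (fun t => - F t) s = - cob F s.
Proof. by rewrite /cob -sumrN; apply: eq_bigr => i _; rewrite mulrN. Qed.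

Lemma cobZ a F s : cob (fun t => a * F t) s = a * cob F s.
Proof. by rewrite /cob mulr_sumr; apply: eq_bigr => i _; rewrite mulrCA. Qed.

Lemma cupA F G H s : cup (cup F G) H s = cup F (cup G H) s.
Proof.
elim: s F G => [|x s IH] F G; first by rewrite !cup_nil.
rewrite !cup_cons cup_nil addr0.
rewrite (eq_cup (F := fun t => cup F G (x :: t))
  (F' := fun t => F [:: x] * G (x :: t) + cup (fun t => F (x :: t)) G t)
  (G' := H)) //; last by move=> t; rewrite cup_cons.
by rewrite cupDl IH (cupZl _ (fun t => G (x :: t))); ring.
Qed.

Lemma cobK F s : cob (cob F) s = 0.
Proof.
elim: s F => [|x s IH] F; first by rewrite cob_nil.
rewrite cob_cons (eq_cob (F := fun t => cob F (x :: t))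
  (F' := fun t => F t + - cob (fun u => F (x :: u)) t)); last first.
  by move=> t; rewrite cob_cons.
by rewrite (cobD F) cobN IH oppr0 addr0 subrr.
Qed.

Lemma cob_cup F G s : G [::] = 0 ->
  cob (cup F G) s =
  cup (cob F) G s - cup (fun t => (-1) ^+ size t * F t) (cob G) s - F [::] * G s.
Proof.
move=> G0; elim: s F => [|x s IH] F.
  by rewrite !cob_nil !cup_nil G0 mulr0 !subr0.
rewrite cob_cons !cup_cons.
rewrite (eq_cob (F := fun t => cup F G (x :: t))
  (F' := fun t => F [:: x] * G (x :: t) + cup (fun u => F (x :: u)) G t));
  last by move=> t; rewrite cup_cons.
rewrite cobD (cobZ _ (fun t => G (x :: t))) IH.
rewrite (eq_cup (F := fun t => cob F (x :: t)) (F' := fun t => F t + - cob (fun u => F (x :: u)) t)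
  (G' := G)) //; last by move=> t; rewrite cob_cons.
rewrite cupDl cupNl !cob_cons cob_nil /=.
rewrite (eq_cup (F := fun t => (-1) ^+ size (x :: t) * F (x :: t))
  (F' := fun t => - ((-1) ^+ size t * F (x :: t))) (G' := cob G)) //; last first.
  by move=> t /=; rewrite exprS mulN1r mulNr.
by rewrite cupNl; ring.
Qed.

End SeqCochains.

Section Degenerate.
Variables (k : comPzRingType) (V : eqType).
Implicit Types (F G : seq V -> k) (s t : seq V).

Definition nondeg s := sorted (fun x y => x != y) s.
Definition normal F := forall s, ~~ nondeg s -> F s = 0.

Lemma cup_deg F G : normal F -> normal G -> normal (cup F G).
Proof.
move=> FN GN s sN; apply: big1 => i _.
have [tN|/FN->] := boolP (nondeg (take i.+1 s)); last by rewrite mul0r.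
have [dN|/GN->] := boolP (nondeg (drop i s)); last by rewrite mulr0.
case/negP: sN; case: i tN dN => i /= ilt; case: s ilt => [//|x0 s']; set s := x0 :: s' => ilt.
move=> /(sortedP x0) tN /(sortedP x0) dN; apply/(sortedP x0) => j jlt.
have [ji|ij] := ltnP j i.
  have := tN j; rewrite !nth_take; [apply|lia|lia].
  by rewrite size_takel ?ltnS.
have := dN (j - i)%N; rewrite !nth_drop size_drop addnS subnKC //; apply; lia.
Qed.

Lemma cob_deg F : normal F -> normal (cob F).
Proof.
move=> FN s; elim: s F FN => [//|x [//|y s] IH] F FN.
have [<- _|xy] := eqVneq x y.
  rewrite !cob_cons (eq_cob (F' := fun=> 0 * (0 : k))).
    by rewrite (cobZ 0 (fun=> 0)) mul0r opprB addrCA subrr addr0.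
  by move=> t; rewrite mul0r; apply: FN; rewrite /nondeg /= eqxx.
rewrite /nondeg /= xy /= => sN.
rewrite cob_cons FN // IH ?subr0 // => t tN; apply: FN; apply: contra tN.
by case: t => //= a t /andP[].
Qed.

End Degenerate.

Section Vertices.
Variables (n : nat) (S : nsSet n).
Implicit Types (s t u : tot S) (c : seq (simp S ord0)).

Lemma vertex_face (p q : 'I_n.+1) (f : dinj p q) (x : simp S q) i :
  vertex (face f x) i = vertex x (val f i).
Proof.
apply: (etrans (esym (congr1 (@^~ x) (@fmapM _ _ (ns_fun S) q p ord0 (vertex_map i) f)))).
congr (@fmap _ _ (ns_fun S) q ord0 _ x).
by apply/val_inj/ffunP => j; rewrite !ffunE.
Qed.

Lemma vertex_distinct (p : 'I_n.+1) (x : simp S p) : injective (vertex x).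
Proof.
have [p0|] := posnP p; last exact: ns_distinct.
by move=> [i Hi] [j Hj] _; apply: val_inj => /=; lia.
Qed.

Lemma size_verts s : size (verts s) = (tag s).+1.
Proof. by rewrite size_map size_enum_ord. Qed.

Lemma verts_neq0 s : verts s != [::].
Proof. by rewrite -size_eq0 size_verts. Qed.

Lemma nth_verts x0 s (i : 'I_(tag s).+1) : nth x0 (verts s) i = vertex (tagged s) i.
Proof. by rewrite (nth_map ord0) ?size_enum_ord // nth_ord_enum. Qed.

Lemma verts_inj : injective (@verts n S).
Proof.
move=> [p x] [q y] E; have := congr1 size E; rewrite !size_verts /= => -[/val_inj pq].
subst q; congr existT; apply: ns_determined => i.
have := congr1 (fun c => nth (vertex x i) c i) E.
by rewrite (nth_verts _ (s := Tagged (simp S) x)) (nth_verts _ (s := Tagged (simp S) y)).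
Qed.

Lemma uniq_verts s : uniq (verts s).
Proof. by rewrite map_inj_uniq ?enum_uniq //; apply: vertex_distinct. Qed.

Definition simplexb c := [exists s, verts s == c].

Lemma simplexP c : reflect (exists s, verts s = c) (simplexb c).
Proof. by apply: (iffP existsP) => -[s /eqP]; exists s => //; apply/eqP. Qed.

Lemma simplexb_verts s : simplexb (verts s).
Proof. by apply/simplexP; exists s. Qed.

Lemma simplexb_nondeg c : simplexb c -> nondeg c.
Proof.
case/simplexP => s <-; have := uniq_verts s; case: (verts s) => // x r.
elim: r x => //= y r IH x /andP[]; rewrite inE negb_or => /andP[-> _] /=; exact: IH.
Qed.

Lemma simplexb_nil : simplexb [::] = false.
Proof. by apply/simplexP => -[s /eqP]; rewrite (negPf (verts_neq0 s)). Qed.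

Lemma simplexb_sub c c' : simplexb c -> subseq c' c -> c' != [::] -> simplexb c'.
Proof.
case/simplexP => -[q x] <- {c} /[dup] /size_subseq.
rewrite size_verts /= => sz /subseqP[m szm c'E] c'0.
set s := Tagged (simp S) x.
pose w := mask m (iota 0 q.+1); pose x0 := vertex x ord0.
have c'w : c' = [seq nth x0 (verts s) i | i <- w].
  by rewrite c'E /w map_mask; congr mask; rewrite -[LHS](mkseq_nth x0) size_verts.
have szw : size w = size c' by rewrite c'w size_map.
have wlt i : (i < size w)%N -> (nth 0%N w i < q.+1)%N.
  by move=> iw; have /mem_mask := mem_nth 0%N iw; rewrite mem_iota.
have wsort : sorted ltn w.
  by apply: (subseq_sorted ltn_trans) (iota_ltn_sorted 0 q.+1); apply: mask_subseq.
have c'S : (size c').-1.+1 = size c' by rewrite prednK // lt0n size_eq0.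
have pn : ((size c').-1 < n.+1)%N by rewrite c'S; apply: leq_trans sz (ltn_ord q).
pose p : 'I_n.+1 := Ordinal pn.
pose f : {ffun 'I_p.+1 -> 'I_q.+1} := [ffun i : 'I_p.+1 => inord (nth 0%N w i)].
have fE (i : 'I_p.+1) : f i = nth 0%N w i :> nat.
  by rewrite ffunE inordK // wlt // szw -c'S.
have fP : monotone f && injectiveb f.
  have flt (i j : 'I_p.+1) : (i < j)%N -> (f i < f j)%N.
    move=> ij; rewrite !fE; apply: (sorted_ltn_nth ltn_trans) => //; rewrite ?inE szw -c'S //.
  apply/andP; split.
    by apply/monotoneP => i j; rewrite leq_eqVlt => /orP[/eqP/val_inj->//|/flt/ltnW].
  apply/injectiveP => i j ij; apply/val_inj.
  by case: (ltngtP i j) => // /flt; rewrite ij ltnn.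
apply/simplexP; exists (Tagged (simp S) (face (exist _ f fP : dinj p q) x)).
apply: (@eq_from_nth _ x0) => [|i]; first by rewrite size_verts /= c'S.
rewrite size_verts => ip.
rewrite -[i]/(nat_of_ord (Ordinal ip)) nth_verts /= vertex_face /=.
rewrite -(nth_verts x0 (s := s)) fE /= [in RHS]c'w (nth_map 0%N) //.
by rewrite szw -c'S.
Qed.

Lemma simplexb_take c i : simplexb c -> (i < size c)%N -> simplexb (take i.+1 c).
Proof.
move=> cS ic; apply: simplexb_sub cS (take_subseq _ _) _.
by rewrite -size_eq0 size_takel.
Qed.

Lemma simplexb_drop c i : simplexb c -> (i < size c)%N -> simplexb (drop i c).
Proof.
move=> cS ic; apply: simplexb_sub cS (drop_subseq _ _) _.
by rewrite -size_eq0 size_drop subn_eq0 -ltnNge.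
Qed.

Lemma del_subseq (V : eqType) j (c : seq V) : subseq (del j c) c.
Proof.
rewrite -[X in subseq _ X](cat_take_drop j) cat_subseq //.
by rewrite -addn1 addnC -drop_drop drop_subseq.
Qed.

Lemma simplexb_del c j : simplexb c -> del j c = [::] \/ simplexb (del j c).
Proof.
move=> cS; have [|d0] := eqVneq (del j c) [::]; [by left|right].
exact: simplexb_sub cS (del_subseq _ _) d0.
Qed.

Lemma verts_coface (p q : 'I_n.+1) (e : q = p.+1 :> nat) j (x : simp S q) :
  verts (Tagged (simp S) (face (coface e j) x)) = del j (verts (Tagged (simp S) x)).
Proof.
set s := Tagged (simp S) x; pose x0 := vertex x ord0.
have js : (j < size (verts s))%N by rewrite size_verts.
apply: (@eq_from_nth _ x0).
  rewrite size_verts /= size_cat size_takel ?size_drop; last exact: ltnW.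
  rewrite size_verts /=; have := ltn_ord j; lia.
rewrite size_verts /= => i ip.
rewrite -[i in LHS]/(nat_of_ord (Ordinal ip)) nth_verts /= vertex_face.
rewrite -(nth_verts x0 (s := s)) ffunE /= /bump nth_cat size_takel; last exact: ltnW.
case: (leqP j i) => ij; last by rewrite nth_take.
by rewrite nth_drop; congr nth; lia.
Qed.

End Vertices.

Section OmegaTheory.
Variables (k : fieldType) (n : nat) (S : nsSet n).
Implicit Types (f g h : Omega k S) (s t u : tot S) (c : seq (simp S ord0)).

Definition ev f c : k := \sum_(s | verts s == c) f s.

Lemma ev_verts f s : ev f (verts s) = f s.
Proof.
rewrite /ev (bigD1 s) //= big1 ?addr0 // => t /andP[/eqP/verts_inj->].
by rewrite eqxx.
Qed.

Lemma ev_non f c : ~~ simplexb c -> ev f c = 0.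
Proof.
by move=> cS; apply: big1 => s sc; case/negP: cS; apply/existsP; exists s.
Qed.

Lemma ev_nil f : ev f [::] = 0. Proof. by rewrite ev_non // simplexb_nil. Qed.

Lemma ev_normal f : normal (ev f).
Proof. by move=> c cN; apply: ev_non; apply: contra cN; apply: simplexb_nondeg. Qed.

Lemma evP f g : (forall c, simplexb c -> ev f c = ev g c) -> f = g.
Proof.
by move=> fg; apply/ffunP => s; rewrite -!ev_verts fg // simplexb_verts.
Qed.

Lemma evL (a : k) f g c : ev (a *: f + g) c = a * ev f c + ev g c.
Proof.
by rewrite /ev mulr_sumr -big_split; apply: eq_bigr => s _; rewrite !ffunE.
Qed.

Lemma ev_ind f c : ev f c = \sum_s (verts s == c)%:R * f s.
Proof.
by rewrite /ev big_mkcond; apply: eq_bigr => s _; case: eqP; rewrite ?mul1r ?mul0r.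
Qed.

Lemma rhoE s t : rho k s t = (t == s)%:R.
Proof. by rewrite ffunE. Qed.

Lemma head_verts x0 s : head x0 (verts s) = vertex (tagged s) ord0.
Proof. by rewrite -nth0 -(nth_verts x0). Qed.

Lemma last_verts x0 s : last x0 (verts s) = vertex (tagged s) ord_max.
Proof. by rewrite -nth_last size_verts -(nth_verts x0). Qed.

Lemma wedge_rhoE s t u : wedge_rho k s t u =
  ((vertex (tagged s) ord_max == vertex (tagged t) ord0) &&
   (verts u == verts s ++ behead (verts t)))%:R.
Proof.
rewrite /wedge_rho; case: eqP => _ /=; last by rewrite ffunE.
case: pickP => [v /eqP vE|no]; last by rewrite no ffunE.
by rewrite rhoE -vE (inj_eq (@verts_inj _ _)).
Qed.

Lemma wedgeE f g u : wedge f g u = \sum_s \sum_t f s * g t * wedge_rho k s t u.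
Proof.
rewrite /wedge sum_ffunE; apply: eq_bigr => s _.
by rewrite sum_ffunE; apply: eq_bigr => t _; rewrite ffunE.
Qed.

Lemma split_count (V : eqType) (x0 : V) (a b c : seq V) : a != [::] -> b != [::] ->
  \sum_(i < size c) (a == take i.+1 c)%:R * (b == drop i c)%:R
  = ((last x0 a == head x0 b) && (c == a ++ behead b))%:R :> k.
Proof.
move=> a0 b0; have [/andP[/eqP ab /eqP cE]|H] := boolP (_ && _).
  have sa : (0 < size a)%N by rewrite lt0n size_eq0.
  have ic : ((size a).-1 < size c)%N by rewrite cE size_cat; lia.
  have tE : take (size a) c = a by rewrite cE take_size_cat.
  have dE : drop (size a).-1 c = b.
    rewrite cE drop_cat prednK // leqnn.
    have -> : drop (size a).-1 a = [:: last x0 a].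
      by rewrite (drop_nth x0) ?prednK // drop_oversize ?nth_last.
    by case: b b0 ab {cE} => //= y b _ ->.
  rewrite (bigD1 (Ordinal ic)) //= prednK // tE dE !eqxx mul1r big1 ?addr0 // => i /eqP ne.
  case: eqP => [aE|]; last by rewrite mul0r.
  by case: ne; apply: val_inj => /=; rewrite [in RHS]aE size_takel.
apply: big1 => i _; case: eqP => [aE|]; last by rewrite mul0r.
case: eqP => [bE|]; last by rewrite mulr0.
case/negP: H; have ic := ltn_ord i.
rewrite aE bE (drop_nth x0) //= cat_take_drop eqxx andbT.
by rewrite (take_nth x0) // last_rcons.
Qed.

Lemma ev_wedge f g c : simplexb c -> ev (wedge f g) c = cup (ev f) (ev g) c.
Proof.
case/simplexP => u <-; rewrite ev_verts wedgeE /cup.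
transitivity (\sum_(i < size (verts u)) \sum_s \sum_t
    ((verts s == take i.+1 (verts u))%:R * f s) * ((verts t == drop i (verts u))%:R * g t)).
  2: by apply: eq_bigr => i _; rewrite !ev_ind big_distrlr.
rewrite [RHS]exchange_big /=; apply: eq_bigr => s _.
rewrite [RHS]exchange_big /=; apply: eq_bigr => t _.
rewrite wedge_rhoE; move: (vertex (tagged s) ord0) => x0.
rewrite -(last_verts x0) -(head_verts x0 t) -split_count ?verts_neq0 //.
by rewrite mulr_sumr; apply: eq_bigr => i _; ring.
Qed.

Lemma ev_one c : simplexb c -> ev (Omega1 k S) c = (size c == 1%N)%:R.
Proof.
case/simplexP => u <-; rewrite ev_verts size_verts eqSS /Omega1 sum_ffunE.
case: u => p x /=; have [p0|p0] := eqVneq (p : nat) 0%N.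
  have {}p0 : p = ord0 by apply: val_inj.
  subst p; rewrite (bigD1 x) //= rhoE eqxx big1 ?addr0 // => v vx.
  by rewrite rhoE eq_Tagged /= eq_sym (negPf vx).
rewrite big1 // => v _; rewrite rhoE; case: eqP => // /(congr1 (@tag _ _)) /= pE.
by case/eqP: p0; rewrite pE.
Qed.

Lemma diff_rhoE s u : diff_rho k s u =
  \sum_(j < size (verts u)) (-1) ^+ j * (verts s == del j (verts u))%:R.
Proof.
case: u => p y; rewrite /diff_rho sum_ffunE /=.
have [ps|ps] := eqVneq (p : nat) (tag s).+1; last first.
  rewrite !big1 // => [j _|q _].
    have := ltn_ord j; move: (nat_of_ord j) => {}j; rewrite size_verts => jp.
    case: eqP => [/(congr1 size)|]; last by rewrite mulr0.
    rewrite size_cat size_takel ?size_drop ?size_verts /= => [E|]; last exact: ltnW.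
    by case/eqP: ps; move: jp E => /=; lia.
  case: eqP => e; last by rewrite ffunE.
  rewrite sum_ffunE big1 // => j _; rewrite ffunE sum_ffunE big1 ?mulr0 ?scaler0 // => t _.
  rewrite rhoE; case: eqP => // /(congr1 (@tag _ _)) /= pq.
  by case/eqP: ps; rewrite pq.
rewrite (bigD1 p) //= [X in _ + X]big1 ?addr0 => [|q qp]; last first.
  by case: eqP => // e; [case/eqP: qp; apply: val_inj => /=; lia|rewrite ffunE].
case: eqP => // e; rewrite sum_ffunE.
rewrite (_ : size _ = p.+1) ?size_verts //; apply: eq_bigr => j _.
rewrite ffunE -[LHS]/(_ * _) sum_ffunE; congr (_ * _).
rewrite -(verts_coface e) (inj_eq (@verts_inj _ _)).
case: s e ps => q x /= e ps.
have [xy|xy] := eqVneq x (face (coface e j) y); last first.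
  rewrite big1 => [|t /eqP tx].
    by case: eqP => // /eqP; rewrite eq_Tagged /= (negPf xy).
  by rewrite rhoE eq_Tagged /=; case: eqP => // yt; rewrite yt tx eqxx in xy.
rewrite {1 2}xy eqxx (bigD1 y) ?xy //= rhoE eqxx big1 ?addr0 // => t /andP[_ ty].
by rewrite rhoE eq_Tagged /= eq_sym (negPf ty).
Qed.

Lemma ev_diff f c : simplexb c -> ev (diff f) c = cob (ev f) c.
Proof.
case/simplexP => u <-; rewrite ev_verts /diff sum_ffunE /cob.
transitivity (\sum_(j < size (verts u)) \sum_s
    (-1) ^+ j * ((verts s == del j (verts u))%:R * f s) : k).
  2: by apply: eq_bigr => j _; rewrite ev_ind mulr_sumr.
rewrite [RHS]exchange_big /=; apply: eq_bigr => s _.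
rewrite ffunE -[LHS]/(_ * _) diff_rhoE mulr_sumr; apply: eq_bigr => j _; ring.
Qed.

Lemma eq_cup_simplex (F F' G G' : seq (simp S ord0) -> k) c :
  (forall d, simplexb d -> F d = F' d) -> (forall d, simplexb d -> G d = G' d) ->
  simplexb c -> cup F G c = cup F' G' c.
Proof.
move=> FF GG cS; apply: eq_bigr => i _.
by rewrite FF ?GG //; [apply: simplexb_drop|apply: simplexb_take].
Qed.

Lemma eq_cob_simplex (F F' : seq (simp S ord0) -> k) c :
  F [::] = F' [::] -> (forall d, simplexb d -> F d = F' d) ->
  simplexb c -> cob F c = cob F' c.
Proof.
move=> F0 FF cS; apply: eq_bigr => i _.
by case: (simplexb_del i cS) => [->|/FF->]; rewrite ?F0.
Qed.

Lemma wedgeA : associative (@wedge k n S).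
Proof.
move=> f g h; apply: evP => c cS; rewrite !ev_wedge //.
rewrite (eq_cup_simplex (F' := ev f) (G' := cup (ev g) (ev h))) //; last exact: ev_wedge.
rewrite -cupA; apply: eq_cup_simplex => // d dS; by rewrite ev_wedge.
Qed.

Lemma wedge1 : left_id (Omega1 k S) (@wedge k n S).
Proof.
move=> f; apply: evP => -[|x c] cS; first by rewrite simplexb_nil in cS.
rewrite ev_wedge // /cup big_ord_recl /= take0 ev_one ?mul1r ?drop0 //; last first.
  by have := simplexb_take (i := 0) cS isT; rewrite /= take0.
rewrite big1 ?addr0 // => i _; have ic := ltn_ord i.
rewrite -[x :: take _ _]/(take i.+2 (x :: c)) ev_one; last exact: simplexb_take.
by rewrite size_takel ?mul0r.
Qed.

Lemma wedgeo1 : right_id (Omega1 k S) (@wedge k n S).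
Proof.
move=> f; apply: evP => c cS; rewrite ev_wedge // /cup.
case: (lastP c) cS => [|{}c x] cS; first by rewrite simplexb_nil in cS.
rewrite size_rcons big_ord_recr /= take_oversize ?size_rcons //.
rewrite ev_one ?simplexb_drop ?size_rcons // size_drop size_rcons subSnn mulr1.
rewrite big1 ?add0r // => i _; have ic := ltn_ord i.
rewrite ev_one ?simplexb_drop ?size_rcons 1?ltnW // size_drop size_rcons.
by case: eqP; rewrite ?mulr0 //; lia.
Qed.

Lemma wedgel g : linear (fun f => wedge f g).
Proof.
move=> a f f'; apply: evP => c cS; rewrite evL !ev_wedge // -cupZl -cupDl.
by apply: eq_cup => // d; rewrite evL.
Qed.

Lemma wedger f : linear (wedge f).
Proof.
move=> a g g'; apply: evP => c cS; rewrite evL !ev_wedge //.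
rewrite /cup mulr_sumr -big_split; apply: eq_bigr => i _.
by rewrite evL /=; ring.
Qed.

Lemma diffL : linear (@diff k n S).
Proof.
move=> a g g'; apply: evP => c cS; rewrite evL !ev_diff // -cobZ -cobD.
by apply: eq_cob => d; rewrite evL.
Qed.

Lemma diffK f : diff (diff f) = 0.
Proof.
apply: evP => c cS; rewrite !ev_diff //.
rewrite (eq_cob_simplex (F' := cob (ev f))) ?cobK ?ev_nil ?cob_nil //; last exact: ev_diff.
by apply/esym/big1 => s _; rewrite ffunE.
Qed.

Lemma Omega_deg_ev p f c : Omega_deg p f -> size c != p.+1 -> ev f c = 0.
Proof.
by move=> fp cp; apply: big1 => s /eqP sc; apply: fp; rewrite -sc size_verts in cp.
Qed.

Lemma ev_Omega_deg p f :
  (forall c, simplexb c -> size c != p.+1 -> ev f c = 0) -> Omega_deg p f.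
Proof. by move=> H s sp; rewrite -ev_verts H ?simplexb_verts ?size_verts. Qed.

Lemma Omega_deg0 p : Omega_deg p (0 : Omega k S).
Proof. by move=> s _; rewrite ffunE. Qed.

Lemma Omega_degL p (a : k) f g : Omega_deg p f -> Omega_deg p g -> Omega_deg p (a *: f + g).
Proof. by move=> fp gp s sp; rewrite !ffunE fp // gp // scaler0 addr0. Qed.

Lemma Omega_direct f : exists! u : {ffun 'I_n.+1 -> Omega k S},
  (forall p : 'I_n.+1, Omega_deg p (u p)) /\ f = \sum_p u p.
Proof.
exists [ffun p : 'I_n.+1 => [ffun s : tot S => if tag s == p then f s else 0] : Omega k S].
split; first split.
- by move=> p s sp; rewrite !ffunE ifN.
- apply/ffunP => s; rewrite sum_ffunE (bigD1 (tag s)) //= !ffunE eqxx big1 ?addr0 // => p ps.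
  by rewrite !ffunE eq_sym (negPf ps).
move=> u [up fE]; apply/ffunP => p; apply/ffunP => s; rewrite !ffunE.
case: eqP => [<-|/eqP sp]; last by rewrite up.
rewrite fE sum_ffunE (bigD1 (tag s)) //= big1 ?addr0 // => q qs.
by rewrite up // eq_sym.
Qed.

Lemma Omega_concentrated p f : (n < p)%N -> Omega_deg p f -> f = 0.
Proof.
move=> np fp; apply/ffunP => s; rewrite ffunE fp //.
by have := ltn_ord (tag s); rewrite ltnS; case: eqP => // ->; rewrite leqNgt np.
Qed.

Lemma Omega_deg1 : Omega_deg 0 (Omega1 k S).
Proof. by apply: ev_Omega_deg => c cS /negPf c1; rewrite ev_one ?c1. Qed.

Lemma Omega_degM p q f g : Omega_deg p f -> Omega_deg q g -> Omega_deg (p + q) (wedge f g).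
Proof.
move=> fp gq; apply: ev_Omega_deg => c cS cpq; rewrite ev_wedge //.
apply: big1 => i _; have := ltn_ord i; move: (nat_of_ord i) => {}i ic.
have [ip|ip] := eqVneq (size (take i.+1 c)) p.+1; last by rewrite (Omega_deg_ev fp) ?mul0r.
rewrite (Omega_deg_ev gq) ?mulr0 // size_drop.
by move: ip; rewrite size_takel //; move/eqP: cpq => cpq ip; apply/eqP; lia.
Qed.

Lemma Omega_degd p f : Omega_deg p f -> Omega_deg p.+1 (diff f).
Proof.
move=> fp; apply: ev_Omega_deg => c cS cp; rewrite ev_diff //.
apply: big1 => i _; have := ltn_ord i; move: (nat_of_ord i) => {}i ic.
rewrite (Omega_deg_ev fp) ?mulr0 // size_cat size_takel ?size_drop 1?ltnW //.
by move/eqP: cp => cp; apply/eqP; lia.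
Qed.

Lemma Omega_leibniz p f g : Omega_deg p f ->
  diff (wedge f g) = wedge (diff f) g + (-1) ^+ p *: wedge f (diff g).
Proof.
move=> fp; apply: evP => c cS; rewrite addrC evL !ev_wedge // ev_diff //.
rewrite (eq_cob_simplex (F' := cup (ev f) (ev g))) ?ev_nil ?cup_nil //; last exact: ev_wedge.
rewrite cob_cup ?ev_nil // mul0r subr0 addrC; congr (_ + _);
  last by apply: eq_cup_simplex => // d dS; rewrite ev_diff.
rewrite -cupNl -cupZl; apply: eq_cup_simplex => // d dS; last by rewrite ev_diff.
have [->|dp] := eqVneq (size d) p.+1; first by rewrite exprS mulN1r mulNr opprK.
by rewrite (Omega_deg_ev fp dp) !mulr0 oppr0.
Qed.

Definition OmegaDG : dgAlg k n :=
  @DgAlg k n (Omega k S) (Omega1 k S) (@wedge k n S) (@diff k n S) (@Omega_deg k n S)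
    wedgeA wedge1 wedgeo1 wedgel wedger Omega_deg0 Omega_degL Omega_direct
    Omega_concentrated Omega_deg1 Omega_degM diffL Omega_degd diffK Omega_leibniz.

End OmegaTheory.

Section DegreeZero.
Variable n : nat.
Implicit Types S T : nsSet n.

Lemma vertex0 S (v : simp S ord0) i : vertex v i = v.
Proof.
rewrite -[RHS](congr1 (@^~ v) (@fmap1 _ _ (ns_fun S) ord0)).
congr (@fmap _ _ (ns_fun S) ord0 ord0 _ v).
by apply/val_inj/ffunP => j; rewrite !ffunE (ord1 i) (ord1 j).
Qed.

Lemma hat_in0K S (v : simp S ord0) : hat_out0 (hat_in0 v) = v.
Proof. exact: vertex0. Qed.

Lemma hat_out0K S (z : hat S ord0 : Type) : hat_in0 (hat_out0 z) = z.
Proof.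
case: z => q [s x]; rewrite /hat_out0.
have q0 : q = ord0.
  by apply: val_inj; rewrite /= -(dsurj_max s) (ord1 ord_max) dsurj0.
subst q; rewrite vertex0; have -> // : s = dsurj_id 0.
by apply/val_inj/ffunP => i; rewrite ffunE (ord1 i) dsurj0.
Qed.

Definition nondegenerate S (p : 'I_n.+1) (x : simp S p) : hat S p : Type :=
  existT _ p (dsurj_id p, x).

Program Definition em_vertex (p : 'I_n.+1) (i : 'I_p.+1) :
    epi_mono (dmap_comp (dmap_of_surj (dsurj_id p)) (dmap_of_inj (vertex_map i))) :=
  @EpiMono n ord0 p _ ord0 (dsurj_id 0) (vertex_map i) _.
Next Obligation. by move=> p i j; rewrite /= !ffunE. Qed.

Lemma hat_vertex S (p : 'I_n.+1) (x : simp S p) i :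
  @fmap _ _ (hat S) p ord0 (vertex_map i) (nondegenerate x) = hat_in0 (vertex x i).
Proof. exact: (Lmk_irr (X := ssSet_of S) _ (em_vertex i) x erefl). Qed.

Lemma hat_out0_vertex S (p q : 'I_n.+1) (s : dsurj p q) (y : simp S q) i :
  hat_out0 (@fmap _ _ (hat S) p ord0 (vertex_map i) (existT _ q (s, y) : (hat S p : Type)))
  = vertex y (val s i).
Proof.
pose E := epi_mono_of (dmap_comp (dmap_of_surj s) (dmap_of_inj (vertex_map i))).
apply: etrans (vertex_face (em_mono E) y _) _.
by rewrite -(em_eq E) /= !ffunE.
Qed.

Lemma deg0_vertex S T (g : @hom (HatSS n) S T) (p : 'I_n.+1) (x : simp S p) :
  let: existT q (s, y) := g p (nondegenerate x) in
  forall i, deg0 g (vertex x i) = vertex (y : simp T q) (val s i).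
Proof.
have := fun i => congr1 (@^~ (nondegenerate x)) (ntN g (vertex_map i : @hom (op (DeltaInjLe n)) p ord0)).
case E: (g p (nondegenerate x)) => [q [s y]] H i.
rewrite -hat_out0_vertex -E /deg0 -hat_vertex; congr hat_out0; exact: H.
Qed.

Lemma deg0_simplex S T (g : @hom (HatSS n) S T) (u : tot S) :
  nondeg (map (deg0 g) (verts u)) -> simplexb (map (deg0 g) (verts u)).
Proof.
case: u => p x; have := deg0_vertex g x.
case: (g p (nondegenerate x)) => q [s y] H; set u := Tagged (simp S) x.
pose x0 := vertex x ord0; pose y0 := deg0 g x0.
have nthE (i : 'I_p.+1) : nth y0 (map (deg0 g) (verts u)) i = vertex (y : simp T q) (val s i).
  by rewrite (nth_map x0) ?size_verts // (nth_verts x0 (s := u)) H.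
move=> /(sortedP y0); rewrite size_map size_verts => nd.
have sE (i : 'I_p.+1) : val s i = i :> nat.
  case: i => i; elim: i => [|i IH] ip; first by rewrite (_ : Ordinal ip = ord0) ?dsurj0 //; apply: val_inj.
  have ip' := ltnW ip; rewrite (@dsurj_step _ _ s (Ordinal ip')) // IH.
  rewrite -[RHS]addn1; congr (_ + _)%N; apply/eqP; rewrite eqb1.
  have := nd i ip; rewrite (nthE (Ordinal ip')) (nthE (Ordinal ip)).
  by apply: contra => /eqP->.
have qp : q = p by apply: val_inj; rewrite /= -(dsurj_max s) sE.
subst q; apply/simplexP; exists (Tagged (simp T) (y : simp T p)).
apply: (@eq_from_nth _ y0) => [|i]; first by rewrite size_map !size_verts.
rewrite size_verts => ip; rewrite -[i]/(nat_of_ord (Ordinal ip)) nthE.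
rewrite (nth_verts y0 (s := Tagged (simp T) (y : simp T p))); congr vertex.
by apply: val_inj; rewrite /= sE.
Qed.

Lemma deg0_id S : deg0 (idc (S : HatSS n)) =1 id.
Proof. by move=> v; apply: hat_in0K. Qed.

Lemma deg0_comp S T U (h : @hom (HatSS n) T U) (g : @hom (HatSS n) S T) :
  deg0 (comp h g) =1 deg0 h \o deg0 g.
Proof.
move=> v; exact: (congr1 (fun z => hat_out0 (h ord0 z)) (esym (hat_out0K (g ord0 (hat_in0 v))))).
Qed.

End DegreeZero.

Section Pullback.
Variables (k : fieldType) (n : nat).
Implicit Types S T : nsSet n.

Definition pull S T (g : @hom (HatSS n) S T) (f : Omega k T) : Omega k S :=
  \sum_(t : tot T) f t *: \sum_(s : tot S | map (deg0 g) (verts s) == verts t) rho k s.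

Section Morphism.
Variables (S T : nsSet n) (g : @hom (HatSS n) S T).

Lemma ev_pull (f : Omega k T) c : simplexb c -> ev (pull g f) c = ev f (map (deg0 g) c).
Proof.
case/simplexP => u <-; rewrite ev_verts /pull sum_ffunE ev_ind.
apply: eq_bigr => t _; rewrite ffunE -[LHS]/(_ * _) mulrC sum_ffunE; congr (_ * _).
rewrite big_mkcond (bigD1 u) //= big1 ?addr0 => [|s su]; last first.
  by case: ifP => // _; rewrite rhoE eq_sym (negPf su).
by rewrite rhoE eqxx eq_sym; case: ifP.
Qed.

Lemma deg0_nondeg c : simplexb c -> nondeg (map (deg0 g) c) = simplexb (map (deg0 g) c).
Proof.
case/simplexP => u <-; apply/idP/idP; [exact: deg0_simplex|exact: simplexb_nondeg].
Qed.

Lemma pull_linear : linear (pull g).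
Proof. by move=> a f f'; apply: evP => c cS; rewrite evL !ev_pull // evL. Qed.

Lemma pull_one : pull g (Omega1 k T) = Omega1 k S.
Proof.
apply: evP => c cS; rewrite ev_pull // [RHS]ev_one //.
have [tS|] := boolP (simplexb (map (deg0 g) c)); first by rewrite ev_one // size_map.
move=> tS; rewrite ev_non //; case: eqP => // c1.
by move: tS; rewrite -deg0_nondeg //; case: c c1 {cS} => [|x []].
Qed.

Lemma pull_wedge f f' : pull g (wedge f f') = wedge (pull g f) (pull g f').
Proof.
apply: evP => c cS; rewrite ev_pull // [RHS]ev_wedge //.
rewrite (eq_cup_simplex (F' := fun d => ev f (map (deg0 g) d))
  (G' := fun d => ev f' (map (deg0 g) d))) //; try by move=> d dS; rewrite ev_pull.
transitivity (cup (ev f) (ev f') (map (deg0 g) c)).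
  have [tS|tS] := boolP (simplexb (map (deg0 g) c)); first by rewrite ev_wedge.
  by rewrite ev_non // (cup_deg (@ev_normal _ _ _ f) (@ev_normal _ _ _ f')) // deg0_nondeg.
by rewrite /cup size_map; apply: eq_bigr => i _; rewrite -map_take -map_drop.
Qed.

Lemma pull_diff f : pull g (diff f) = diff (pull g f).
Proof.
apply: evP => c cS; rewrite ev_pull // [RHS]ev_diff //.
rewrite (eq_cob_simplex (F' := fun d => ev f (map (deg0 g) d))) ?ev_nil //;
  last by move=> d dS; rewrite ev_pull.
transitivity (cob (ev f) (map (deg0 g) c)).
  have [tS|tS] := boolP (simplexb (map (deg0 g) c)); first by rewrite ev_diff.
  by rewrite ev_non // (cob_deg (@ev_normal _ _ _ f)) // deg0_nondeg.
by rewrite /cob size_map; apply: eq_bigr => i _; rewrite /del -map_take -map_drop -map_cat.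
Qed.

Lemma pull_deg p f : Omega_deg p f -> Omega_deg p (pull g f).
Proof.
move=> fp; apply: ev_Omega_deg => c cS cp.
by rewrite ev_pull // (Omega_deg_ev fp) // size_map.
Qed.

Definition pullDG : dgHom (OmegaDG k T) (OmegaDG k S) :=
  @DgHom k n (OmegaDG k T) (OmegaDG k S) (pull g)
    pull_linear pull_one pull_wedge pull_deg pull_diff.

End Morphism.

Definition Im : category := full_sub (fun A : DG k n => exists S, A = OmegaDG k S).

Definition OmegaIm S : Im := exist _ (OmegaDG k S) (ex_intro _ S erefl).

Program Definition OmegaF : functor (op (HatSS n)) Im :=
  @Functor (op (HatSS n)) Im OmegaIm (fun T S g => pullDG (g : @hom (HatSS n) S T)) _ _.
Next Obligation.
move=> S; apply: dgHom_eq => f; apply: evP => c cS.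
by rewrite ev_pull // (eq_map (@deg0_id _ _)) map_id.
Qed.
Next Obligation.
move=> U T S g h; apply: dgHom_eq => f; apply: evP => c cS.
rewrite [RHS](ev_pull (g : @hom (HatSS n) S T) _ cS).
apply: (etrans (ev_pull _ _ cS)).
rewrite (eq_map (deg0_comp (h : @hom (HatSS n) T U) (g : @hom (HatSS n) S T))) map_comp.
have [tS|tS] := boolP (simplexb (map (deg0 g) c)); first by rewrite ev_pull.
rewrite (ev_non _ tS) ev_non //; apply: contra tS => /simplexb_nondeg.
rewrite -deg0_nondeg //; move: (map (deg0 g) c); case=> // x r.
elim: r x => //= y r IH x /andP[xy /IH ->]; rewrite andbT.
by apply: contra xy => /eqP->.
Qed.

End Pullback.

(* Main.v *)
Require Import Defs.
From mathcomp Require Import all_boot all_order all_algebra.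
From mathcomp Require Import boolp.

(** A simplex [(s, y)] of [hat T] is determined by its vertices: the vertices of
    [y] being distinct, repetitions among those of [(s, y)] give the kernel of [s],
    hence [s], and then [y]. So a map into [hat T] is determined in degree zero,
    where it is read off the pullbacks of the indicator functions [rho [w]]. *)

Local Open Scope ring_scope.

Lemma hat_determined n (T : nsSet n) (p : 'I_n.+1) (z z' : hat T p : Type) :
  (forall i, hat_out0 (@fmap _ _ (hat T) p ord0 (vertex_map i) z)
           = hat_out0 (@fmap _ _ (hat T) p ord0 (vertex_map i) z')) -> z = z'.
Proof.
case: z => q [s y]; case: z' => q' [s' y'] H.
have {}H i : vertex (y : simp T q) (val s i) = vertex (y' : simp T q') (val s' i).
  by have := H i; rewrite !hat_out0_vertex.
have ker i j : (val s i == val s j) = (val s' i == val s' j).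
  apply/eqP/eqP => ij.
    by apply: (@vertex_distinct _ _ _ y'); rewrite -!H ij.
  by apply: (@vertex_distinct _ _ _ y); rewrite !H ij.
have e : q = q' by apply/val_inj/(dsurj_ker_eq ker).
subst q'.
have es : s = s' by apply/val_inj/ffunP => i; apply/val_inj/(dsurj_ker_val ker).
subst s'.
have -> // : y = y'.
(* Since [s] is onto, [H] reaches every vertex of [y] and [y']. *)
apply: ns_determined => i; have [j <-] := dsurj_surj s i; exact: H.
Qed.

Lemma hat_out0_inj n (T : nsSet n) : injective (@hat_out0 n T).
Proof. by move=> z z' E; rewrite -(hat_out0K z) E hat_out0K. Qed.

Lemma hat_hom_deg0 n (S T : nsSet n) (g h : @Defs.hom (HatSS n) S T) :
  deg0 g =1 deg0 h -> g = h.
Proof.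
move=> gh; have gh0 z : g ord0 z = h ord0 z.
  by apply: hat_out0_inj; have := gh (hat_out0 z); rewrite /deg0 hat_out0K.
apply: nat_trans_eq => p; apply: funext => z; apply: hat_determined => i.
(* Naturality along the [i]-th vertex inclusion reduces degree [p] to degree zero, settled by
   [gh0]. *)
have N (f : @Defs.hom (HatSS n) S T) :=
  congr1 (@^~ z) (ntN f (vertex_map i : @Defs.hom (op (DeltaInjLe n)) p ord0)).
congr hat_out0; exact: etrans (etrans (esym (N g)) (gh0 _)) (N h).
Qed.

Lemma verts_vertex n (S : nsSet n) (v : simp S ord0) :
  verts (Tagged (simp S) v) = [:: v].
Proof. by rewrite /verts /= enum_ordSl enum_ord0 /= vertex0. Qed.

Lemma pull_vertex (k : fieldType) n (S T : nsSet n) (g : @Defs.hom (HatSS n) S T)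
    (f : Omega k T) (v : simp S ord0) :
  pull g f (Tagged (simp S) v) = f (Tagged (simp T) (deg0 g v)).
Proof. by rewrite -!ev_verts ev_pull ?simplexb_verts // !verts_vertex. Qed.

Lemma pull_deg0 (k : fieldType) n (S T : nsSet n) (g h : @Defs.hom (HatSS n) S T) :
  @pull k n S T g =1 pull h -> deg0 g =1 deg0 h.
Proof.
move=> gh v; pose r := rho k (Tagged (simp T) (deg0 g v)).
have := congr1 (fun f : Omega k S => f (Tagged (simp S) v)) (gh r).
(* At [v] the pullback of [r] along [g] is 1, while along [h] it is 0 unless [deg0 h v] equals
   [deg0 g v]; a field has [1 != 0]. *)
rewrite /= !pull_vertex !rhoE eqxx; case: eqP => [/eqP|_ /eqP]; last by rewrite GRing.oner_eq0.
by rewrite eq_Tagged /= => /eqP.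
Qed.

Theorem proposition3p8 (k : fieldType) (hk : 2%N \notin [pchar k]) (n : nat) :
  faithful (OmegaF k n).
Proof.
(* An arrow from [T] to [S] in the opposite category is a map [hat S -> hat T], hence the order of
   the names. *)
move=> T S g h gh; apply: (@hat_hom_deg0 n S T); apply: (@pull_deg0 k) => f.
exact: (congr1 (fun F : dgHom (OmegaDG k T) (OmegaDG k S) => F f) gh).
Qed.
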